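(* Let $K,N,N_r,M,S$ be positive integers with $N_r\le N$, $M<N$, $N_r>N-M$, and $N-N_r+2\le S\le N$. Consider the $(K,N,N_r,M,S)$ secure gradient coding problem with uncoded groupwise keys and an arbitrary data assignment $\mathcal D_1,\dots,\mathcal D_K\subseteq[N]$ with minimum replication factor $\min_{k}|\mathcal D_k|=M$. Let $R^*$ be the optimal communication cost of this secure problem, let $R_{\rm n}^*$ be the optimal communication cost of non-secure gradient coding under linear coding, and let $$R=\frac{\binom{N}{S}-\binom{M}{S}}{\left(\binom{N}{S}-\binom{M}{S}\right)N_r-\binom{N}{S}(N-M)}$$ (an achievable communication cost of the secure problem). Then: (1) If $S>M$, then $R$ coincides with $R_{\rm n}^*$ and $$R^*=R_{\rm n}^*=\frac{1}{N_r-N+M}.$$ (2) If $N-N_r+2\le S\le M$, then $R$ is order-optimal within a factor of $2$: $$R_{\rm n}^*\le R\le 2R_{\rm n}^*.$$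
   Context: Notation: $[n]=\{1,\dots,n\}$; $\binom{\mathcal X}{y}$ is the collection of $y$-element subsets of a set $\mathcal X$; $\binom{x}{y}=0$ if $x<y$. $\mathbb F_q$ is a finite field and entropies $H$ and mutual informations $I$ are in base $q$. The $(K,N,N_r,M,S)$ secure gradient coding problem with uncoded groupwise keys: there are $K$ datasets, with gradients $g_1,\dots,g_K\in\mathbb F_q^{L}$ that are mutually independent, each consisting of $L$ i.i.d. uniform symbols on $\mathbb F_q$, and $N$ servers. Data assignment (fixed in advance, arbitrary): dataset $k$ is available exactly at the servers in $\mathcal D_k\subseteq[N]$, where $|\mathcal D_k|\ge M$ and $M$ is the minimum replication factor; write $\mathcal Z_n=\{k\in[K]: n\in\mathcal D_k\}$. Keys: for each $\mathcal V\in\binom{[N]}{S}$ there is a random key $Q_{\mathcal V}$ (its distribution is chosen by the scheme) known exactly to the servers in $\mathcal V$. All keys and all gradients are mutually independent: $H\big((Q_{\mathcal V})_{\mathcal V},(g_k)_{k}\big)=\sum_{\mathcal V}H(Q_{\mathcal V})+\sum_{k}H(g_k)$. A secure gradient coding scheme with block length $L$ consists of a choice of keys and of messages $X_1,\dots,X_N$, where $X_n$ is a vector of $|X_n|$ symbols of $\mathbb F_q$, such that: (i) Encoding: $H\big(X_n\mid (g_k:k\in\mathcal Z_n),(Q_{\mathcal V}: n\in\mathcal V)\big)=0$ for all $n\in[N]$. (ii) Decodability: $H\big(\sum_{k\in[K]}g_k\mid (X_n:n\in\mathcal U)\big)=0$ for all $\mathcal U\in\binom{[N]}{N_r}$. (iii)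 Security: $I\big(X_1,\dots,X_N;g_1,\dots,g_K\mid \sum_{k\in[K]}g_k\big)=0$. The communication cost of a scheme is $\max_{n\in[N]}|X_n|/L$. $R^*$ is the infimum of the communication costs over all block lengths $L$ and all secure gradient coding schemes. Non-secure gradient coding under linear coding: same gradients, servers and data assignment, but no keys and no security requirement; $X_n$ must be an $\mathbb F_q$-linear function of $(g_k:k\in\mathcal Z_n)$, and condition (ii) must hold. $R_{\rm n}^*$ is the infimum of $\max_n|X_n|/L$ over all $L$ and all such linear schemes. It is a known result, which may be used, that $R_{\rm n}^*=\frac{1}{N_r-N+M}$. *)

(* Defs.v *)
From HB Require Import structures.
From mathcomp Require Import classical_sets reals exp.
From mathcomp Require Import all_boot all_order all_algebra.

Set Implicit Arguments.
Unset Strict Implicit.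
Unset Printing Implicit Defensive.

Import Order.TTheory GRing.Theory Num.Theory.
Local Open Scope ring_scope.

(* All random variables take values in finite types, so they are taken to be
   functions on a finite probability space. *)
Record fdist (R : realType) (Omega : finType) := FDist {
  pmf :> Omega -> R;
  pmf_ge0 : forall w, 0 <= pmf w;
  pmf_sum1 : \sum_w pmf w = 1 }.

Section Information.
Variables (R : realType) (Omega : finType) (P : fdist R Omega).

Definition law (T : finType) (X : Omega -> T) (x : T) : R :=
  \sum_(w | X w == x) P w.

Definition pairrv (T U : finType) (X : Omega -> T) (Y : Omega -> U) :
  Omega -> T * U := fun w => (X w, Y w).

(* The family (X_i : i in A), as one random variable; the coordinates outside A
   carry the constant None. *)
Definition joint (I : finType) (T : I -> finType)
    (X : forall i, Omega -> T i) (A : {set I}) :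
    Omega -> {dffun forall i : I, option (T i)} :=
  fun w => [ffun i => if i \in A then Some (X i w) else None].

Definition logb (b : nat) (x : R) : R := ln x / ln b%:R.

(* Terms of probability zero vanish, whatever the value of ln 0. *)
Definition entropy (b : nat) (T : finType) (X : Omega -> T) : R :=
  - \sum_x law X x * logb b (law X x).

Definition cond_entropy (b : nat) (T U : finType)
    (X : Omega -> T) (Y : Omega -> U) : R :=
  - \sum_x \sum_y law (pairrv X Y) (x, y) *
      logb b (law (pairrv X Y) (x, y) / law Y y).

Definition cond_mutual_info (b : nat) (T U V : finType)
    (X : Omega -> T) (Y : Omega -> U) (Z : Omega -> V) : R :=
  cond_entropy b X Z - cond_entropy b X (pairrv Y Z).

Definition mutually_independent (I T : finType) (X : I -> Omega -> T) : Prop :=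
  forall x : I -> T,
    \sum_(w | [forall i, X i w == x i]) P w = \prod_i law (X i) (x i).

(* The joint law of L independent symbols, each uniform on F. *)
Definition iid_uniform (F : finFieldType) (L : nat)
    (X : Omega -> 'rV[F]_L) : Prop :=
  forall v, law X v = \prod_(j < L) (#|F|%:R)^-1.

Definition gradient_source (F : finFieldType) (K L : nat)
    (g : 'I_K -> Omega -> 'rV[F]_L) : Prop :=
  mutually_independent g /\ forall k, iid_uniform (g k).

End Information.

Definition available (K N : nat) (D : 'I_K -> {set 'I_N}) (n : 'I_N) :
  {set 'I_K} := [set k | n \in D k].

Notation key_group N S := {V : {set 'I_N} | #|V| == S}.

Definition known_keys (N S : nat) (n : 'I_N) : {set key_group N S} :=
  [set V : key_group N S | n \in val V].

Definition min_replication (K N : nat) (D : 'I_K -> {set 'I_N}) (M : nat) :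
  Prop := (forall k, (M <= #|D k|)%N) /\ (exists k, #|D k| = M).

Definition decodable (R : realType) (F : finFieldType) (K N L Nr : nat)
    (Omega : finType) (P : fdist R Omega) (g : 'I_K -> Omega -> 'rV[F]_L)
    (len : 'I_N -> nat) (X : forall n, Omega -> 'rV[F]_(len n)) : Prop :=
  forall U : {set 'I_N}, #|U| = Nr ->
    cond_entropy P #|F| (fun w => \sum_k g k w) (joint X U) = 0.

Record secure_scheme (R : realType) (F : finFieldType) (K N Nr S : nat)
    (D : 'I_K -> {set 'I_N}) (L : nat) := SecureScheme {
  ss_space : finType;
  ss_prob : fdist R ss_space;
  ss_grad : 'I_K -> ss_space -> 'rV[F]_L;
  ss_gradP : gradient_source ss_prob ss_grad;
  ss_keyT : key_group N S -> finType;
  ss_key : forall V, ss_space -> ss_keyT V;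
  ss_indep :
    entropy ss_prob #|F| (pairrv (joint ss_key setT) (joint ss_grad setT)) =
    \sum_V entropy ss_prob #|F| (ss_key V)
      + \sum_k entropy ss_prob #|F| (ss_grad k);
  ss_len : 'I_N -> nat;
  ss_msg : forall n, ss_space -> 'rV[F]_(ss_len n);
  ss_encoding : forall n,
    cond_entropy ss_prob #|F| (ss_msg n)
      (pairrv (joint ss_grad (available D n))
              (joint ss_key (known_keys S n))) = 0;
  ss_decodability : decodable Nr ss_prob ss_grad ss_msg;
  ss_security :
    cond_mutual_info ss_prob #|F| (joint ss_msg setT) (joint ss_grad setT)
      (fun w => \sum_k ss_grad k w) = 0 }.

Record linear_scheme (R : realType) (F : finFieldType) (K N Nr : nat)
    (D : 'I_K -> {set 'I_N}) (L : nat) := LinearScheme {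
  ls_space : finType;
  ls_prob : fdist R ls_space;
  ls_grad : 'I_K -> ls_space -> 'rV[F]_L;
  ls_gradP : gradient_source ls_prob ls_grad;
  ls_len : 'I_N -> nat;
  ls_coef : forall n : 'I_N, 'I_K -> 'M[F]_(L, ls_len n);
  ls_msg : forall n, ls_space -> 'rV[F]_(ls_len n) :=
    fun n w => \sum_(k in available D n) ls_grad k w *m ls_coef n k;
  ls_decodability : decodable Nr ls_prob ls_grad ls_msg }.

Definition comm_cost (R : realType) (N L : nat) (len : 'I_N -> nat) : R :=
  (\max_(n < N) len n)%:R / L%:R.

Definition optimal_secure_cost (R : realType) (F : finFieldType)
    (K N Nr S : nat) (D : 'I_K -> {set 'I_N}) : R :=
  inf [set c : R | exists L : nat, (0 < L)%N /\
        exists s : secure_scheme R F Nr S D L, c = comm_cost R L (ss_len s)]%classic.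

Definition optimal_linear_cost (R : realType) (F : finFieldType)
    (K N Nr : nat) (D : 'I_K -> {set 'I_N}) : R :=
  inf [set c : R | exists L : nat, (0 < L)%N /\
        exists s : linear_scheme R F Nr D L, c = comm_cost R L (ls_len s)]%classic.

Definition groupwise_key_cost (R : realType) (N Nr M S : nat) : R :=
  ('C(N, S)%:R - 'C(M, S)%:R) /
  (('C(N, S)%:R - 'C(M, S)%:R) * Nr%:R - 'C(N, S)%:R * (N%:R - M%:R)).

(* Main.v *)
(** Write a = N - M and t = Nr - a; both optimal costs are shown to equal 1/t.

    Converse: fix a dataset k held by exactly M servers and Nr receivers that
    include the N - M other servers. With all keys and all other gradients
    fixed, g_k is an injective function of the messages of the t remaining
    receivers, so L <= t * max |X_n|.

    Achievability: over an extension E of F with N points alpha_n and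
    m = dim E, cut g_k into t blocks, read as a polynomial G_k over E of degree
    < t. The codeword X^a G_k - (X^a G_k mod p_k), where p_k has degree a and
    vanishes at the servers without dataset k, also vanishes there, and the sum
    over k of the codewords has degree < Nr with top t coefficients sum_k g_k.
    Server n sends its value at alpha_n. For security, the group V adds a
    random polynomial of degree < a that vanishes outside V; these span all
    polynomials of degree < a when S > M, and hence hide everything except the
    top t coefficients. *)

Require Import Defs.
From HB Require Import structures.
From mathcomp Require Import classical_sets reals exp.
From mathcomp Require Import all_boot all_order all_algebra all_field ring lra zify.

Set Implicit Arguments.
Unset Strict Implicit.
Unset Printing Implicit Defensive.

Import Order.TTheory GRing.Theory Num.Theory VectorInternalTheory.
Local Open Scope ring_scope.

(** * Finite sets and binomial coefficients *)

Lemma exists_subset_card (T : finType) (A : {set T}) (n : nat) :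
  (n <= #|A|)%N -> exists2 B : {set T}, B \subset A & #|B| = n.
Proof.
move=> nA; exists [set x in take n (enum A)].
  by apply/subsetP=> x; rewrite inE => /mem_take; rewrite mem_enum.
rewrite cardsE; have /card_uniqP-> : uniq (take n (enum A)).
  by rewrite take_uniq ?enum_uniq.
by rewrite size_takel // -cardE.
Qed.

(** Passing from [M + a] to [M + a + 1] multiplies the binomial by [(M+a+1)/(M+a+1-S)], which is at
    least [(M+a+3-S)/(M+a+1-S)] because [2 <= S]; the product of the latter ratios telescopes. *)
Lemma binomial_decay (a M S : nat) : (2 <= S)%N -> (S <= M)%N ->
  ('C(M, S) * ((M + a - S).+1 * (M + a - S).+2) <=
   'C(M + a, S) * ((M - S).+1 * (M - S).+2))%N.
Proof.
move=> S2 SM; elim: a => [|a IHa]; first by rewrite addn0.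
have := mul_bin_down (M + a).+1 S; rewrite /= addnS.
set C' := 'C((M + a).+1, S); move: IHa; set C := 'C(M + a, S); set c := 'C(M, S).
rewrite subSn; last lia.
have [d ->] : exists d, M = (S + d)%N by exists (M - S)%N; lia.
have -> : (S + d + a - S = d + a)%N by lia.
have -> : (S + d - S = d)%N by lia.
move=> IHa eqC.
rewrite -(@leq_pmul2l (d + a).+1) // [leqRHS]mulnA -eqC.
move: (leq_mul (leqnn (d + a).+3) IHa) => IH2.
have h : (c * ((d + a).+2 * (d + a).+3) * (d + a).+1 =
          (d + a).+3 * (c * ((d + a).+1 * (d + a).+2)))%N by ring.
rewrite mulnC h; apply: leq_trans IH2 _.
have -> : ((S + d + a).+1 * C * (d.+1 * d.+2) =
           (S + d + a).+1 * (C * (d.+1 * d.+2)))%N by ring.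
rewrite leq_mul2r; apply/orP; right; lia.
Qed.

(** * Entropy on a finite probability space *)

Section Laws.
Variables (R : realType) (Omega : finType) (P : fdist R Omega) (b : nat).
Hypothesis b_gt1 : (1 < b)%N.

Lemma law_ge0 (T : finType) (X : Omega -> T) x : 0 <= law P X x.
Proof. by apply: sumr_ge0 => w _; apply: pmf_ge0. Qed.

Lemma pmf_le_law (T : finType) (X : Omega -> T) w : P w <= law P X (X w).
Proof.
rewrite /law (bigD1 w) //= lerDl.
by apply: sumr_ge0 => w' _; apply: pmf_ge0.
Qed.

Lemma law_gt0 (T : finType) (X : Omega -> T) w : 0 < P w -> 0 < law P X (X w).
Proof. by move/lt_le_trans; apply; apply: pmf_le_law. Qed.

Lemma law_gt0_ex (T : finType) (X : Omega -> T) x :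
  0 < law P X x -> exists2 w, 0 < P w & X w = x.
Proof.
rewrite /law => h; have [w /andP[/eqP Xw Pw]|none] := pickP (fun w => (X w == x) && (0 < P w)).
  by exists w.
move: h; rewrite big1 ?ltxx // => w Xw; move: (none w); rewrite Xw /=.
by move/negbT; rewrite -leNgt => Pw; apply/eqP; rewrite eq_le Pw pmf_ge0.
Qed.

Lemma pmf_support_ex : exists w, 0 < P w.
Proof.
have [w Pw|none] := pickP (fun w => 0 < P w); first by exists w.
have := pmf_sum1 P; rewrite big1 => [/eqP|w _]; first by rewrite eq_sym oner_eq0.
by move: (none w) => /negbT; rewrite -leNgt => Pw; apply/eqP; rewrite eq_le Pw pmf_ge0.
Qed.

Lemma sum_law (T : finType) (X : Omega -> T) (f : T -> R) :
  \sum_x law P X x * f x = \sum_w P w * f (X w).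
Proof.
rewrite [RHS](partition_big X xpredT) //=; apply: eq_bigr => x _.
by rewrite /law big_distrl; apply: eq_bigr => w /eqP->.
Qed.

Lemma law_sum1 (T : finType) (X : Omega -> T) : \sum_x law P X x = 1.
Proof.
under eq_bigr do rewrite -[law _ _ _]mulr1; rewrite (sum_law X (fun=> 1)).
by under eq_bigr do rewrite mulr1; apply: pmf_sum1.
Qed.

Lemma entropyE (T : finType) (X : Omega -> T) :
  entropy P b X = - \sum_w P w * logb b (law P X (X w)).
Proof. by rewrite /entropy sum_law. Qed.

Lemma cond_entropyE (T U : finType) (X : Omega -> T) (Y : Omega -> U) :
  cond_entropy P b X Y =
  - \sum_w P w * logb b (law P (pairrv X Y) (X w, Y w) / law P Y (Y w)).
Proof.
rewrite /cond_entropy pair_bigA /=.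
under eq_bigr do rewrite -surjective_pairing.
by rewrite (sum_law (pairrv X Y)
  (fun p => logb b (law P (pairrv X Y) p / law P Y p.2))).
Qed.

Lemma law_split (T U : finType) (X : Omega -> T) (Y : Omega -> U) x y :
  law P Y y =
  law P (pairrv X Y) (x, y) + \sum_(w | (Y w == y) && (X w != x)) P w.
Proof.
rewrite /law (bigID (fun w => X w == x)) /=; congr (_ + _).
by apply: eq_bigl => w; rewrite /pairrv xpair_eqE andbC.
Qed.

Lemma ln_base_gt0 : 0 < ln (b%:R : R) :> R.
Proof. by apply: ln_gt0; rewrite ltr1n. Qed.

Lemma logb_le0 (x : R) : x <= 1 -> logb b x <= 0.
Proof.
by move=> x1; rewrite /logb pmulr_lle0 ?invr_gt0 ?ln_base_gt0 // ln_le0.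
Qed.

(** The ratios of laws are at most 1, so all terms have one sign and a zero sum forces ratio 1 on
    the support. Encoding and decodability thereby become functional dependence between outcomes. *)
Lemma cond_entropy_eq0 (T U : finType) (X : Omega -> T) (Y : Omega -> U) :
  cond_entropy P b X Y = 0 <->
  (forall w w', 0 < P w -> 0 < P w' -> Y w = Y w' -> X w = X w').
Proof.
rewrite cond_entropyE; split.
- move/eqP; rewrite oppr_eq0 -oppr_eq0 -sumrN => /eqP sum0 w w' Pw Pw' YY.
  have term_ge0 v : 0 <= - (P v *
      logb b (law P (pairrv X Y) (X v, Y v) / law P Y (Y v))).
    rewrite oppr_ge0 mulr_ge0_le0 ?pmf_ge0 // logb_le0 //.
    have [->|nz] := eqVneq (law P Y (Y v)) 0; first by rewrite invr0 mulr0 ler01.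
    rewrite ler_pdivrMr ?lt_def ?nz ?law_ge0 // mul1r (law_split X Y (X v)).
    by rewrite lerDl; apply: sumr_ge0 => *; apply: pmf_ge0.
  have /(_ w isT)/eqP := psumr_eq0P (fun v _ => term_ge0 v) sum0.
  rewrite oppr_eq0 mulf_eq0 gt_eqF //= /logb mulf_eq0 invr_eq0.
  rewrite (gt_eqF ln_base_gt0) orbF.
  have lp : 0 < law P (pairrv X Y) (X w, Y w) by exact: (law_gt0 (pairrv X Y) Pw).
  rewrite ln_eq0 ?divr_gt0 ?law_gt0 // => /eqP r1.
  have := law_split X Y (X w) (Y w).
  have lY : law P Y (Y w) != 0 by rewrite gt_eqF ?law_gt0.
  have -> : law P (pairrv X Y) (X w, Y w) = law P Y (Y w).
    by rewrite -[LHS](divfK lY) r1 mul1r.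
  move=> h.
  have /psumr_eq0P h0 : \sum_(v | (Y v == Y w) && (X v != X w)) P v = 0.
    by apply/(addrI (law P Y (Y w))); rewrite -h addr0.
  apply/eqP; apply: contraT => neq.
  have : P w' = 0.
    by apply: h0 => [v _|]; rewrite ?pmf_ge0 // YY eqxx eq_sym neq.
  by move=> P0; move: Pw'; rewrite P0 ltxx.
- move=> det; rewrite big1 ?oppr0 // => w _.
  have [->|Pw0] := eqVneq (P w) 0; first by rewrite mul0r.
  have Pw : 0 < P w by rewrite lt_def Pw0 pmf_ge0.
  rewrite [law P Y _](law_split X Y (X w)) [X in _ + X]big1 ?addr0.
    rewrite divff ?/logb ?ln1 ?mul0r ?mulr0 // gt_eqF //.
    exact: (law_gt0 (pairrv X Y) Pw).
  move=> w' /andP[/eqP YY /eqP neq]; apply/eqP; rewrite eq_le pmf_ge0 andbT leNgt.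
  by apply/negP => Pw'; apply: neq; apply: det.
Qed.

End Laws.

(* Gibbs' inequality for the joint law against the product [marg] of the
   marginals: additivity of entropies leaves no mass of [marg] outside the
   support of the joint law. *)
Lemma additive_entropy_support (R : realType) (Omega : finType)
    (P : fdist R Omega) (b : nat) (I U : finType) (T : I -> finType)
    (X : forall i, Omega -> T i) (Z : Omega -> U) (x : forall i, T i) :
  (1 < b)%N -> (forall w w', (forall i, X i w = X i w') -> Z w = Z w') ->
  entropy P b Z = \sum_i entropy P b (X i) ->
  (forall i, 0 < law P (X i) (x i)) ->
  exists2 w, 0 < P w & forall i, X i w = x i.
Proof.
move=> b_gt1 detZ entZ lawx.
(* Tagging puts the values of the dependent family in one type, so that a product of sums can be
   expanded. *)
pose Y i w := Tagged T (X i w).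
have lawY i y : law P (Y i) (Tagged T y) = law P (X i) y.
  by apply: eq_bigl => w; rewrite /Y eq_Tagged.
pose V w := [ffun i => Y i w].
pose marg (f : {ffun I -> {i & T i}}) : R := \prod_i law P (Y i) (f i).
have marg_ge0 f : 0 <= marg f by apply: prodr_ge0 => i _; apply: law_ge0.
have marg_sum1 : \sum_f marg f = 1.
  rewrite -(bigA_distr_bigA (fun i y => law P (Y i) y)) big1 // => i _.
  exact: law_sum1.
have margV w : marg (V w) = \prod_i law P (X i) (X i w).
  by apply: eq_bigr => i _; rewrite ffunE lawY.
have lawVZ w : law P V (V w) <= law P Z (Z w).
  rewrite /law [leRHS](bigID (fun w' => V w' == V w)) /= ler_wpDr //.
    by apply: sumr_ge0 => *; apply: pmf_ge0.
  rewrite le_eqVlt; apply/orP; left; apply/eqP; apply: eq_bigl => w'.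
  case: eqP => [/ffunP VV|]; rewrite ?andbF // andbT; symmetry; apply/eqP.
  apply: detZ => i; move: (VV i); rewrite !ffunE => /eqP.
  by rewrite eq_Tagged => /eqP.
(* [ln y <= y - 1] at [y = marg (V w) / law P V (V w)], together with [lawVZ]. *)
have bound w : P w * (ln (marg (V w)) - ln (law P Z (Z w))) <=
    P w * (marg (V w) / law P V (V w) - 1).
  have [->|Pw0] := eqVneq (P w) 0; first by rewrite !mul0r.
  have Pw : 0 < P w by rewrite lt_def Pw0 pmf_ge0.
  rewrite ler_pM2l //.
  have lV : 0 < law P V (V w) by apply: law_gt0.
  have mV : 0 < marg (V w) by rewrite margV; apply: prodr_gt0 => i _; apply: law_gt0.
  apply: (@le_trans _ _ (ln (marg (V w)) - ln (law P V (V w)))).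
    by rewrite lerD2l lerN2 ler_ln ?posrE // (lt_le_trans lV).
  rewrite -ln_div ?posrE //.
  have := @le_ln1Dx R (marg (V w) / law P V (V w) - 1).
  by rewrite [1 + _]addrC subrK; apply; rewrite ltrBrDl subrr divr_gt0.
have sum0 : \sum_w P w * (ln (marg (V w)) - ln (law P Z (Z w))) = 0.
  move: entZ; rewrite entropyE.
  under [RHS]eq_bigr do rewrite entropyE.
  rewrite sumrN exchange_big /= => /oppr_inj.
  move/(congr1 ( *%R (ln b%:R))); rewrite !mulr_sumr => eqs.
  have lb0 : ln b%:R != 0 :> R by rewrite gt_eqF ?ln_base_gt0.
  under eq_bigr do rewrite mulrBr.
  rewrite sumrB; apply/eqP; rewrite subr_eq0; apply/eqP.
  transitivity (\sum_w ln b%:R * (P w * logb b (law P Z (Z w)))).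
    rewrite eqs; apply: eq_bigr => w _.
    have [->|Pw0] := eqVneq (P w) 0.
      by rewrite mul0r big1 ?mulr0 // => i _; rewrite mul0r.
    have Pw : 0 < P w by rewrite lt_def Pw0 pmf_ge0.
    rewrite margV -mulr_sumr mulrCA; congr (_ * _).
    rewrite (big_morph_in Num.pos (@ln R) (op1 := +%R) (id1 := 0)) ?ln1 ?rpred1 //.
    - rewrite mulr_sumr; apply: eq_bigr => i _.
      by rewrite /logb mulrCA mulfV // mulr1.
    - by move=> y z; apply: rpredM.
    - by move=> y z; apply: lnM.
    - by move=> i _; rewrite posrE law_gt0.
  by apply: eq_bigr => w _; rewrite /logb mulrCA [ln b%:R * _]mulrC divfK.
have : 0 <= \sum_w P w * (marg (V w) / law P V (V w) - 1).
  by rewrite -[X in X <= _]sum0; apply: ler_sum.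
under eq_bigr do rewrite mulrBr mulr1.
rewrite sumrB pmf_sum1 -(sum_law P V (fun f => marg f / law P V f)) subr_ge0.
(* The left side 1 is the total mass of [marg], the right side its mass on the support of [V]; so
   the mass off the support is at most 0. *)
rewrite -[X in X <= _]marg_sum1 (bigID (fun f => law P V f == 0)) /=.
rewrite [leRHS](bigID (fun f => law P V f == 0)) /=.
rewrite [X in _ <= X + _]big1 => [|f /eqP->]; last by rewrite mul0r.
rewrite [X in _ <= _ + X](eq_bigr marg) => [|f nz]; last first.
  by rewrite mulrCA mulfV // mulr1.
rewrite lerD2r => sum_le0.
pose fx := [ffun i => Tagged T (x i)].
have mfx : 0 < marg fx by apply: prodr_gt0 => i _; rewrite ffunE lawY.
have : law P V fx != 0.
  apply: contraTN sum_le0 => l0; rewrite -ltNge (bigD1 fx) //= ltr_wpDr //.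
  by apply: sumr_ge0.
move=> nz; have /law_gt0_ex [w Pw Vw] : 0 < law P V fx.
  by rewrite lt_def nz law_ge0.
exists w => // i; move/ffunP: Vw => /(_ i); rewrite !ffunE => /eqP.
by rewrite eq_Tagged => /eqP.
Qed.

Lemma uniform_law_gt0 (R : realType) (Omega : finType) (P : fdist R Omega)
    (F : finFieldType) (L : nat) (X : Omega -> 'rV[F]_L) v :
  iid_uniform P X -> 0 < law P X v.
Proof.
move=> ->; apply: prodr_gt0 => i _; rewrite invr_gt0 ltr0n.
by apply/card_gt0P; exists 0.
Qed.

Lemma jointE_in (Omega I : finType) (T : I -> finType)
    (X : forall i, Omega -> T i) (A : {set I}) w w' :
  (forall i, i \in A -> X i w = X i w') -> joint X A w = joint X A w'.
Proof.
by move=> eqX; apply/ffunP => i; rewrite !ffunE; case: ifP => // /eqX->.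
Qed.

Lemma joint_inj_in (Omega I : finType) (T : I -> finType)
    (X : forall i, Omega -> T i) (A : {set I}) w w' i :
  joint X A w = joint X A w' -> i \in A -> X i w = X i w'.
Proof.
by move=> /ffunP/(_ i); rewrite !ffunE => + iA; rewrite iA => -[].
Qed.

(* Fixing the keys and all gradients but the k0-th, the latter is determined by
   the messages of the Nr - #|~: A| servers of a set of receivers containing
   the complement of A. *)
Lemma message_length_lower_bound (R : realType) (F : finFieldType)
    (K N L Nr : nat) (Omega Q : finType) (P : fdist R Omega)
    (g : 'I_K -> Omega -> 'rV[F]_L) (q : Omega -> Q) (q0 : Q)
    (D : 'I_K -> {set 'I_N}) (len : 'I_N -> nat)
    (X : forall n, Omega -> 'rV[F]_(len n)) (k0 : 'I_K) (t : nat) :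
  (Nr <= N)%N -> (N - #|D k0| + t = Nr)%N ->
  (forall v : 'I_K -> 'rV[F]_L,
     exists w, [/\ 0 < P w, q w = q0 & forall k, g k w = v k]) ->
  (forall n w w', 0 < P w -> 0 < P w' -> q w = q w' ->
     (forall k, k \in available D n -> g k w = g k w') -> X n w = X n w') ->
  decodable Nr P g X ->
  (L <= t * \max_(n < N) len n)%N.
Proof.
move=> NrN eqNr full enc dec.
have cardC : (#|~: D k0| + #|D k0| = N)%N by rewrite addnC cardsC card_ord.
have [W WD cW] : exists2 W : {set 'I_N}, W \subset D k0 & #|W| = t.
  by apply: exists_subset_card; lia.
have cU : #|~: D k0 :|: W| = Nr.
  rewrite cardsU (_ : _ :&: W = set0) ?cards0; first lia.
  apply/setP=> n; rewrite !inE.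
  by case: (boolP (n \in W)) => [/(subsetP WD)->|]; rewrite ?andbF.
have F1 : (1 < #|F|)%N by apply: finNzRing_gt1.
have /cond_entropy_eq0 := dec _ cU => /(_ F1) det.
pose z (v : 'rV[F]_L) k : 'rV[F]_L := if k == k0 then v else 0.
have wP v : {w | [&& 0 < P w, q w == q0 & [forall k, g k w == z v k]]}.
  apply/sigW; have [w [Pw qw gw]] := full (z v).
  by exists w; rewrite Pw qw eqxx; apply/forallP=> k; rewrite gw.
pose w_ v := sval (wP v).
have Pw v : 0 < P (w_ v) by have /and3P[] := svalP (wP v).
have qw v : q (w_ v) = q0 by have /and3P[_ /eqP] := svalP (wP v).
have gw v k : g k (w_ v) = z v k.
  by have /and3P[_ _ /forallP/(_ k)/eqP] := svalP (wP v).
set m := \max_(n < N) len n.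
(* The messages of the servers in [W], padded with zeros to the common length [m]. Outside [W] the
   value is 0, so at most [#|F| ^ (t * m)] codes exist. *)
pose code v : {ffun 'I_N * 'I_m -> F} := [ffun p =>
  if p.1 \in W then
    (if insub (val p.2) is Some j then X p.1 (w_ v) 0 j else 0) else 0].
have codeP v : code v \in pffun_on (0 : F) (setX W setT) predT.
  apply/pffun_onP; split=> //; apply/supportP=> -[n j]; rewrite !inE andbT /=.
  by rewrite ffunE => /negbTE->.
have code_inj : injective code.
  move=> v v' eqc.
  have : joint X (~: D k0 :|: W) (w_ v) = joint X (~: D k0 :|: W) (w_ v').
    (* Servers outside [D k0] do not hold the one gradient that varies; the messages of the others
       are read off the code. *)
    apply: jointE_in => n; rewrite !inE => /orP[nD|nW].
      apply: enc; rewrite ?Pw ?qw // => k; rewrite inE => nk; rewrite !gw /z.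
      by case: eqP nk nD => // -> ->.
    apply/rowP=> j; have jm : (j < m)%N.
      by apply: leq_trans (ltn_ord j) _; apply: leq_bigmax.
    move/ffunP: eqc => /(_ (n, Ordinal jm)); rewrite !ffunE /= nW.
    case: insubP => [j' _ /= ej|]; last by rewrite ltn_ord.
    by have -> : j' = j by apply: val_inj.
  move/det => /(_ (Pw v) (Pw v')).
  by rewrite (bigD1 k0) //= [RHS](bigD1 k0) //= !big1 ?gw /z ?eqxx ?addr0 // => k /negbTE;
     rewrite gw /z => ->.
have : (#|'rV[F]_L| <= #|pffun_on (0%R : F) (setX W [set: 'I_m]) predT|)%N.
  rewrite -(card_image code_inj); apply: subset_leq_card; apply/subsetP=> f.
  by case/imageP => v _ ->.
rewrite card_mx mul1n card_pffun_on cardsX cW cardsT card_ord leq_exp2l //.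
Qed.

(** * Polynomial codes *)

(** With [p] the characteristic and [n = p * N + 1], the image of [n] in the field is 1, so
    [X^n - 1] is separable and has [n > N] distinct roots in its splitting field. *)
Lemma extension_with_points (F : finFieldType) (N : nat) :
  exists (E : fieldExtType F) (alpha : 'I_N -> E), injective alpha.
Proof.
have [p p_prime pF] := finPcharP F.
pose n := (p * N).+1; pose f : {poly F} := 'X^n - 1.
have fn0 : f != 0 by rewrite monic_neq0 // monicXnsubC.
have [E [rs frs _]] := FinSplittingFieldFor fn0.
have {}frs : ('X^n - 1 : {poly E}) %= \prod_(z <- rs) ('X - z%:P).
  by move: frs; rewrite /f rmorphB rmorph1 /= map_polyXn.
have pE : p \in [pchar E] by rewrite pchar_lalg.
have n1 : n%:R = 1 :> E by rewrite /n -addn1 natrD natrM pcharf0 // mul0r add0r.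
have rs_uniq : uniq rs.
  rewrite -separable_prod_XsubC -(eqp_separable frs).
  by rewrite cyclotomic.separable_Xn_sub_1 // n1 oner_eq0.
have size_rs : size rs = n.
  apply: succn_inj; rewrite -(size_prod_XsubC _ id) -(eqp_size frs).
  by rewrite size_XnsubC.
have lt_rs (i : 'I_N) : (i < size rs)%N.
  rewrite size_rs ltnS (leq_trans (ltnW (ltn_ord i))) // leq_pmull //.
  exact: prime_gt0.
exists E, (fun i : 'I_N => nth 0 rs i) => i j /eqP.
by rewrite nth_uniq // => /eqP/val_inj.
Qed.

Section PolynomialCode.
Variables (F : finFieldType) (E : fieldExtType F).
Local Notation m := (dim E).

Definition block_poly (t : nat) (v : 'rV[F]_(t * m)) : {poly E} :=
  rVpoly (\row_(i < t) r2v (row i (vec_mx v))).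

Lemma block_poly_is_zmod_morphism t : zmod_morphism (@block_poly t).
Proof.
move=> u v; rewrite /block_poly -raddfB; congr rVpoly; apply/rowP=> i.
by rewrite !mxE !raddfB.
Qed.

HB.instance Definition _ t :=
  GRing.isZmodMorphism.Build _ _ (@block_poly t) (@block_poly_is_zmod_morphism t).

Lemma block_polyZ t c (v : 'rV[F]_(t * m)) :
  block_poly (c *: v) = c%:A *: block_poly v.
Proof.
rewrite /block_poly -linearZ; congr rVpoly; apply/rowP=> i.
by rewrite !mxE !linearZ /= mulr_algl.
Qed.

Lemma size_block_poly t (v : 'rV[F]_(t * m)) : (size (block_poly v) <= t)%N.
Proof. exact: size_poly. Qed.

Lemma block_poly_inj t : injective (@block_poly t).
Proof.
move=> u v /(congr1 (@poly_rV _ t)); rewrite !rVpolyK => /rowP uv.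
rewrite -[u]vec_mxK -[v]vec_mxK; congr mxvec; apply/row_matrixP=> i.
by have := uv i; rewrite !mxE => /(can_inj r2vK).
Qed.

Lemma block_poly_onto t (r : {poly E}) :
  (size r <= t)%N -> exists v : 'rV[F]_(t * m), block_poly v = r.
Proof.
move=> rt; exists (mxvec (\matrix_i v2r (poly_rV r 0 i : E))).
rewrite /block_poly -[RHS](poly_rV_K rt); congr rVpoly; apply/rowP=> i.
by rewrite mxvecK mxE rowK v2rK.
Qed.

Variables (N : nat) (alpha : 'I_N -> E).
Hypothesis alpha_inj : injective alpha.

Definition vanishing (A : {set 'I_N}) : {poly E} :=
  \prod_(n in A) ('X - (alpha n)%:P).

Lemma vanishing_monic (A : {set 'I_N}) : vanishing A \is monic.
Proof. by apply: monic_prod => n _; apply: monicXsubC. Qed.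

Lemma size_vanishing (A : {set 'I_N}) : size (vanishing A) = #|A|.+1.
Proof. by rewrite /vanishing -big_enum size_prod_XsubC -cardE. Qed.

Lemma vanishing_root (A : {set 'I_N}) n : n \in A -> (vanishing A).[alpha n] = 0.
Proof.
by move=> nA; rewrite /vanishing (bigD1 n) //= hornerM !hornerE subrr mul0r.
Qed.

Lemma poly_eq_on (U : {set 'I_N}) (p q : {poly E}) :
  (size p <= #|U|)%N -> (size q <= #|U|)%N ->
  (forall n, n \in U -> p.[alpha n] = q.[alpha n]) -> p = q.
Proof.
move=> sp sq pq; apply/eqP; rewrite -subr_eq0; apply/eqP.
apply: (@roots_geq_poly_eq0 _ _ [seq alpha n | n <- enum U]).
- apply/allP=> _ /mapP[n nU ->]; rewrite mem_enum in nU.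
  by rewrite /root !hornerE pq // subrr.
- by rewrite map_inj_uniq ?enum_uniq.
- by rewrite size_map -cardE (leq_trans (size_polyD _ _)) // size_polyN geq_max sp.
Qed.

Section Codeword.
Variables (a t : nat) (p : {poly E}).

Definition codeword (v : 'rV[F]_(t * m)) : {poly E} :=
  'X^a * block_poly v - ('X^a * block_poly v) %% p.

Lemma codeword_is_zmod_morphism : zmod_morphism codeword.
Proof.
move=> u v; rewrite /codeword raddfB mulrBr modpD modpN.
by ring.
Qed.

HB.instance Definition _ :=
  GRing.isZmodMorphism.Build _ _ codeword codeword_is_zmod_morphism.

Lemma codewordZ c v : codeword (c *: v) = c%:A *: codeword v.
Proof. by rewrite /codeword block_polyZ -scalerAr modpZl scalerBr. Qed.

Lemma codeword_root x v : root p x -> (codeword v).[x] = 0.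
Proof.
move=> /rootP px; rewrite /codeword {1}(divp_eq ('X^a * block_poly v) p) addrK.
by rewrite hornerM px mulr0.
Qed.

End Codeword.

Lemma size_codeword_form a t (v : 'rV[F]_(t * m)) (l : {poly E}) :
  (size l <= a)%N -> (size ('X^a * block_poly v + l)%R <= a + t)%N.
Proof.
move=> la; rewrite (leq_trans (size_polyD _ _)) // geq_max.
rewrite (leq_trans la (leq_addr _ _)) andbT.
have [->|nz] := eqVneq (block_poly v) 0; first by rewrite mulr0 size_poly0.
by rewrite size_monicM ?monicXn // size_polyXn /= leq_add2l size_block_poly.
Qed.

(** Both polynomials have degree below [a + t = #|U|], hence coincide. The terms [l] and [l'] do not
    reach the coefficients from [a] on, which are those of the block polynomials. *)
Lemma codeword_form_decode a t (v v' : 'rV[F]_(t * m)) (l l' : {poly E})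
    (U : {set 'I_N}) :
  (size l <= a)%N -> (size l' <= a)%N -> #|U| = (a + t)%N ->
  (forall n, n \in U -> ('X^a * block_poly v + l).[alpha n] =
                        ('X^a * block_poly v' + l').[alpha n]) ->
  v = v'.
Proof.
move=> la la' cU eqU; apply: block_poly_inj; apply/polyP=> i.
have := poly_eq_on _ _ eqU; rewrite cU !size_codeword_form // => /(_ isT isT).
move/(congr1 (fun p : {poly E} => p`_(a + i))).
rewrite !coefD !coefXnM !ltnNge leq_addr /= addKn.
by rewrite ![_`_(a + i)]nth_default ?addr0 // (leq_trans _ (leq_addr _ _)).
Qed.

(* Downward induction on the number of prescribed roots: for b <> b' the
   difference of ('X - b) and ('X - b') is a nonzero constant. *)
Lemma vanishing_span (a s : nat) : (s < N)%N -> (s < a)%N ->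
  forall (B : {set 'I_N}) (r : {poly E}),
  (#|B| <= s)%N -> (size r <= a - #|B|)%N ->
  exists c : {set 'I_N} -> {poly E},
    (forall A, (size (c A) <= a - s)%N) /\
    vanishing B * r = \sum_(A : {set 'I_N} | #|A| == s) vanishing A * c A.
Proof.
move=> sN sa B; move Ed : (s - #|B|)%N => d.
elim: d B Ed => [|d IHd] B Ed r Bs sr.
  have eB : #|B| = s by lia.
  exists (fun A => if A == B then r else 0); split.
    by move=> A; case: ifP => _; rewrite ?size_poly0 // -eB.
  rewrite (bigD1 B) ?eB //= eqxx big1 ?addr0 // => A /andP[_ /negbTE->].
  by rewrite mulr0.
(* [#|B| < s < N] leaves two points outside [B]. *)
have [W WB cW] : exists2 W : {set 'I_N}, W \subset ~: B & #|W| = 2.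
  apply: exists_subset_card; have := cardsC B; rewrite card_ord; lia.
have /cards2P [x [y [xy eW]]] : #|W| == 2 by rewrite cW.
have xB : x \notin B by move/subsetP: WB => /(_ x); rewrite eW !inE eqxx => ->.
have yB : y \notin B.
  by move/subsetP: WB => /(_ y); rewrite eW !inE eqxx orbT => ->.
have vU z : z \notin B -> vanishing (z |: B) = ('X - (alpha z)%:P) * vanishing B.
  by move=> zB; rewrite /vanishing big_setU1.
(* By [s < a], one more root still leaves room for a nonzero constant cofactor. *)
have aB : (0 < a - #|B|.+1)%N by clear -Ed sa; lia.
pose r' := r %/ ('X - (alpha x)%:P); pose c := r.[alpha x].
have dxy : alpha y - alpha x != 0.
  by rewrite subr_eq0; apply: contraNneq xy => /alpha_inj->.
(* Chosen so that [e] times the difference of ['X - alpha x] and ['X - alpha y] is the remainder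
   [c]. Thus [r] combines these two factors with cofactors [r' + e] and [- e]. *)
pose e := c / (alpha y - alpha x).
have er : r = r' * ('X - (alpha x)%:P) + c%:P.
  by rewrite {1}(divp_eq r ('X - (alpha x)%:P)) modp_XsubC.
have sr' : (size r' <= a - #|B|.+1)%N.
  rewrite size_divp ?polyXsubC_eq0 // size_XsubC (subnS a) -[leqLHS]/(size r - 1)%N.
  by rewrite subn1 -!subn1 leq_sub2r.
have [|||c1 [s1 e1]] := IHd (x |: B) _ (r' + e%:P).
- by rewrite cardsU1 xB; lia.
- by rewrite cardsU1 xB; lia.
- rewrite cardsU1 xB (leq_trans (size_polyD _ _)) // geq_max.
  by rewrite (leq_trans sr') //= (leq_trans (size_polyC_leq1 _)).
have [|||c2 [s2 e2]] := IHd (y |: B) _ (- e%:P).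
- by rewrite cardsU1 yB; lia.
- by rewrite cardsU1 yB; lia.
- by rewrite cardsU1 yB size_polyN (leq_trans (size_polyC_leq1 _)).
exists (fun A => c1 A + c2 A); split.
  by move=> A; rewrite (leq_trans (size_polyD _ _)) // geq_max s1 s2.
transitivity (vanishing (x |: B) * (r' + e%:P) + vanishing (y |: B) * (- e%:P)).
  rewrite !vU // {1}er.
  have -> : c%:P = e%:P * ((alpha y)%:P - (alpha x)%:P) :> {poly E}.
    by rewrite -polyCB -polyCM /e divfK.
  by ring.
by rewrite e1 e2 -big_split; apply: eq_bigr => A _; rewrite mulrDr.
Qed.

End PolynomialCode.

(** * Uniform sources *)

Section Uniform.
Variables (R : realType) (Omega : finType) (w0 : Omega).

Lemma uniform_ge0 (w : Omega) : 0 <= (#|Omega|%:R^-1 : R).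
Proof. by rewrite invr_ge0. Qed.

Lemma uniform_sum1 : \sum_(w : Omega) (#|Omega|%:R^-1 : R) = 1.
Proof.
rewrite sumr_const -[LHS]mulr_natl mulfV // pnatr_eq0 -lt0n.
by apply/card_gt0P; exists w0.
Qed.

Definition uniform_fdist : fdist R Omega :=
  FDist uniform_ge0 uniform_sum1.

(** Each fibre of [X] injects into every other one, so all have the same mass, and these masses sum
    to 1 over [T]. *)
Lemma law_equidistributed (T : finType) (X : Omega -> T) :
  (forall x y, exists2 f : Omega -> Omega,
     {in [pred w | X w == x] &, injective f} &
     forall w, X w = x -> X (f w) = y) ->
  forall x, law uniform_fdist X x = #|T|%:R^-1.
Proof.
move=> transl x.
have cst y z : law uniform_fdist X y <= law uniform_fdist X z.
  rewrite /law !sumr_const -!(mulr_natr _^-1) ler_wpM2l ?invr_ge0 // ler_nat.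
  have [f f_inj fX] := transl y z.
  rewrite -(card_in_imset f_inj) subset_leq_card //.
  by apply/subsetP=> _ /imsetP[w + ->]; rewrite !inE => /eqP/fX/eqP.
have s1 : #|T|%:R * law uniform_fdist X x = 1.
  rewrite mulr_natl -sumr_const -[RHS](law_sum1 uniform_fdist X).
  by apply: eq_bigr => y _; apply/eqP; rewrite eq_le !cst.
have nz : #|T|%:R != 0 :> R.
  by apply: contra_eq_neq s1 => ->; rewrite mul0r eq_sym oner_neq0.
by apply: (mulfI nz); rewrite s1 mulfV.
Qed.

(** Only attained values are constrained: an injective [X] has [n = #|Omega|] even if it is not
    onto. *)
Lemma entropy_equidistributed (b : nat) (T : finType) (X : Omega -> T) (n : nat) :
  (forall w, law uniform_fdist X (X w) = n%:R^-1) -> (0 < n)%N ->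
  entropy uniform_fdist b X = logb b n%:R.
Proof.
move=> lawX n0; rewrite entropyE; under eq_bigr do rewrite lawX.
rewrite -mulr_suml pmf_sum1 mul1r /logb lnV ?posrE ?ltr0n //.
by rewrite mulNr opprK.
Qed.

End Uniform.

Section ProductSpace.
Variables (R : realType) (I J A B : finType) (w0 : {ffun I -> A} * {ffun J -> B}).
Let Omega : finType := ({ffun I -> A} * {ffun J -> B})%type.
Local Notation P := (@uniform_fdist R Omega w0).

Lemma law_fst x : law P (fun w : Omega => w.1) x = (#|A| ^ #|I|)%:R^-1.
Proof.
rewrite -card_ffun; apply: law_equidistributed => {}x y.
exists (fun w : Omega => (y, w.2)) => // -[w1 w2] [v1 v2] /=.
by rewrite !inE /= => /eqP-> /eqP-> [->].
Qed.

Lemma law_fst_coord i x : law P (fun w : Omega => w.1 i) x = #|A|%:R^-1.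
Proof.
apply: law_equidistributed => {}x y.
exists (fun w : Omega => ([ffun j => if j == i then y else w.1 j], w.2)).
  move=> [w1 w2] [v1 v2] /=; rewrite !inE /= => /eqP wx /eqP vx [/ffunP wv ->].
  congr pair; apply/ffunP=> j; have := wv j; rewrite !ffunE.
  by case: eqP => // ->; rewrite wx vx.
by move=> w _; rewrite ffunE eqxx.
Qed.

Lemma law_snd_coord i x : law P (fun w : Omega => w.2 i) x = #|B|%:R^-1.
Proof.
apply: law_equidistributed => {}x y.
exists (fun w : Omega => (w.1, [ffun j => if j == i then y else w.2 j])).
  move=> [w1 w2] [v1 v2] /=; rewrite !inE /= => /eqP wx /eqP vx [-> /ffunP wv].
  congr pair; apply/ffunP=> j; have := wv j; rewrite !ffunE.
  by case: eqP => // ->; rewrite wx vx.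
by move=> w _; rewrite ffunE eqxx.
Qed.

(** An injective variable has entropy [logb b #|Omega|], and [#|Omega|] is the product of the
    alphabet sizes of the coordinates. *)
Lemma product_space_entropy (b : nat) (T : finType) (Z : Omega -> T) :
  injective Z ->
  entropy P b Z = \sum_(j : J) entropy P b (fun w : Omega => w.2 j)
                + \sum_(i : I) entropy P b (fun w : Omega => w.1 i).
Proof.
move=> Z_inj.
have Omega0 : (0 < #|Omega|)%N by apply/card_gt0P; exists w0.
rewrite (@entropy_equidistributed _ _ _ _ _ _ #|Omega|) // => [|w]; last first.
  rewrite /law (eq_bigl (pred1 w)) ?big_pred1_eq // => v /=.
  by rewrite (inj_eq Z_inj).
have cardO : #|Omega| = (#|A| ^ #|I| * #|B| ^ #|J|)%N.
  by rewrite card_prod !card_ffun.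
move: Omega0; rewrite cardO muln_gt0 !expn_gt0 => /andP[A0 B0].
rewrite (eq_bigr (fun=> logb b #|B|%:R)) => [|j _]; last first.
  apply: entropy_equidistributed => [w|]; first exact: law_snd_coord.
  by apply/card_gt0P; exists (w0.2 j).
rewrite [X in _ = _ + X](eq_bigr (fun=> logb b #|A|%:R)) => [|i _]; last first.
  apply: entropy_equidistributed => [w|]; first exact: law_fst_coord.
  by apply/card_gt0P; exists (w0.1 i).
rewrite !sumr_const /logb natrM lnM ?posrE ?ltr0n ?expn_gt0 //.
(* The case [k = 0] covers an empty index set, whose alphabet may be empty too. *)
have lnXn (c k : nat) : (0 < c)%N || (k == 0)%N ->
    ln (c ^ k)%:R = ln (c%:R : R) *+ k.
  case/orP => [c0|/eqP->]; last by rewrite expn0 ln1.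
  by rewrite natrX lnXn ?ltr0n.
by rewrite !lnXn // mulrDl addrC !mulrnAl.
Qed.

End ProductSpace.

Lemma uniform_gradient_source (R : realType) (F : finFieldType) (K L : nat)
    (J B : finType) (w0 : {ffun 'I_K -> 'rV[F]_L} * {ffun J -> B}) :
  gradient_source (uniform_fdist R w0) (fun k w => w.1 k).
Proof.
split=> [x|k v]; last first.
  by rewrite law_fst_coord card_mx mul1n prodr_const card_ord natrX exprVn.
under [RHS]eq_bigr do rewrite law_fst_coord.
rewrite prodr_const exprVn -natrX -(law_fst R w0 (finfun x)).
by apply: eq_bigl => w; apply/forallP/eqP => [xw|-> i];
   [apply/ffunP=> i; rewrite ffunE; apply/eqP|rewrite ffunE].
Qed.

(* [f] re-randomises the keys so as to turn the messages computed from [g] into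
   those computed from [g']. *)
Lemma masked_mutual_info0 (R : realType) (b : nat) (G Q T U V : finType)
    (w0 : G * Q) (X : G * Q -> T) (Y : G * Q -> U) (s : G -> V) :
  (forall w w', (Y w == Y w') = (w.1 == w'.1)) ->
  (forall g g', s g = s g' -> exists2 f : Q -> Q, injective f &
     forall q, X (g', f q) = X (g, q)) ->
  cond_mutual_info (uniform_fdist R w0) b X Y (fun w => s w.1) = 0.
Proof.
move=> Y1 mask; set P := uniform_fdist R w0.
pose u : R := #|{: G * Q}|%:R^-1.
have u_gt0 : 0 < u by rewrite invr_gt0 ltr0n; apply/card_gt0P; exists w0.
(* The probability of [g] together with the value [x] of [X]. Using the masks in both directions
   shows that it depends on [g] only through [s g]. *)
pose f g x := \sum_(q | X (g, q) == x) u.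
have f_le g g' x : s g = s g' -> f g x <= f g' x.
  move=> sg; have [h h_inj hX] := mask _ _ sg.
  rewrite /f !sumr_const -!(mulr_natr u) ler_wpM2l ?(ltW u_gt0) // ler_nat.
  rewrite -(card_imset _ h_inj).
  apply: subset_leq_card; apply/subsetP=> _ /imsetP[q + ->].
  by rewrite -!topredE /= hX.
have f_eq g g' x : s g = s g' -> f g x = f g' x.
  by move=> sg; apply/eqP; rewrite eq_le !f_le.
have sum_fst (C : pred G) (c : pred (G * Q)) :
    \sum_(w | C w.1 && c w) P w = \sum_(g | C g) \sum_(q | c (g, q)) u.
  by rewrite pair_big_dep; apply: eq_big => [[g q]|].
rewrite /cond_mutual_info !cond_entropyE; apply/eqP; rewrite subr_eq0; apply/eqP.
congr (- _); apply: eq_bigr => -[g q] _; congr (_ * logb b _).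
set x := X (g, q).
have -> : law P (pairrv X (fun w => s w.1)) (x, s g) =
    \sum_(g' | s g' == s g) f g' x.
  rewrite -(sum_fst (fun g' => s g' == s g) (fun w => X w == x)).
  by apply: eq_bigl => w; rewrite xpair_eqE andbC.
have -> : law P (fun w => s w.1) (s g) = \sum_(g' | s g' == s g) \sum_(q' : Q) u.
  rewrite -(sum_fst (fun g' => s g' == s g) predT).
  by apply: eq_bigl => w; rewrite andbT.
have -> : law P (pairrv X (pairrv Y (fun w => s w.1))) (x, (Y (g, q), s g)) =
    f g x.
  transitivity (\sum_(g' | g' == g) f g' x); last by rewrite big_pred1_eq.
  rewrite -(sum_fst (pred1 g) (fun w => X w == x)).
  apply: eq_bigl => w /=; rewrite !xpair_eqE Y1 /= andbC -andbA.
  by case: (w.1 =P g) => [->|] //; rewrite eqxx.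
have -> : law P (pairrv Y (fun w => s w.1)) (Y (g, q), s g) = \sum_(q' : Q) u.
  transitivity (\sum_(g' | g' == g) \sum_(q' : Q) u); last by rewrite big_pred1_eq.
  rewrite -(sum_fst (pred1 g) predT).
  apply: eq_bigl => w /=; rewrite !xpair_eqE Y1 /= andbT.
  by case: (w.1 =P g) => [->|] //; rewrite eqxx.
(* All terms being equal, the number of [g'] with [s g' = s g] cancels from numerator and
   denominator; it is positive, as [g] itself counts. *)
rewrite (eq_bigr (fun=> f g x)) => [|g' /eqP sg]; last exact: f_eq.
move: (f g x) (\sum_(q' : Q) u) => y z.
rewrite !sumr_const -(mulr_natr y) -(mulr_natr z) invfM mulrACA divff ?mulr1 //.
rewrite pnatr_eq0 -lt0n; apply/card_gt0P; exists g.
exact: eqxx.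
Qed.

(** * Optimal costs *)

Lemma gradient_source_full (R : realType) (F : finFieldType) (K L : nat)
    (Omega : finType) (P : fdist R Omega) (g : 'I_K -> Omega -> 'rV[F]_L)
    (v : 'I_K -> 'rV[F]_L) :
  gradient_source P g -> exists2 w, 0 < P w & forall k, g k w = v k.
Proof.
move=> [indep unif].
have /law_gt0_ex [w Pw /forallP gw] :
    0 < law P (fun w => [forall k, g k w == v k]) true.
  rewrite /law (eq_bigl (fun w => [forall k, g k w == v k])) => [|w]; last first.
    by rewrite eqb_id.
  by rewrite indep; apply: prodr_gt0 => k _; apply: uniform_law_gt0.
by exists w => // k; apply/eqP.
Qed.

(** * Lower bounds on the communication cost *)

Section Converse.
Variables (R : realType) (F : finFieldType) (K N Nr M : nat).
Variable D : 'I_K -> {set 'I_N}.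
Hypotheses (NrN : (Nr <= N)%N) (MN : (M < N)%N) (NMNr : (N - M < Nr)%N).
Hypothesis repD : min_replication D M.
Let t := (Nr - (N - M))%N.

Lemma comm_cost_ge (L : nat) (len : 'I_N -> nat) : (0 < L)%N ->
  (L <= t * \max_(n < N) len n)%N -> t%:R^-1 <= comm_cost R L len.
Proof.
move=> L0 Lt; have t0 : (0 < t)%N by rewrite subn_gt0.
rewrite /comm_cost ler_pdivlMr ?ltr0n // mulrC ler_pdivrMr ?ltr0n //.
by rewrite -natrM ler_nat mulnC.
Qed.

Lemma linear_cost_ge L (s : linear_scheme R F Nr D L) : (0 < L)%N ->
  t%:R^-1 <= comm_cost R L (ls_len s).
Proof.
move=> L0; apply: comm_cost_ge => //; have [_ [k0 Dk0]] := repD.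
apply: (message_length_lower_bound (D := D) (k0 := k0) (q := fun=> tt) (q0 := tt) NrN
  _ _ _ (ls_decodability s)).
- by rewrite Dk0 /t subnKC // ltnW.
- by move=> v; have [w Pw gw] := gradient_source_full v (ls_gradP s); exists w.
move=> n w w' _ _ _ eqg; apply: eq_bigr => k /eqg gk.
by rewrite gk.
Qed.

(** [ss_indep] expresses independence by additivity of entropies. By [additive_entropy_support], the
    key values seen at an outcome of positive probability occur with every choice of gradients,
    which is what the counting bound requires. *)
Lemma secure_cost_ge S L (s : secure_scheme R F Nr S D L) : (0 < L)%N ->
  t%:R^-1 <= comm_cost R L (ss_len s).
Proof.
move=> L0; apply: comm_cost_ge => //; have [_ [k0 Dk0]] := repD.
have F1 := finNzRing_gt1 F; have [w0 Pw0] := pmf_support_ex (ss_prob s).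
pose keys := joint (@ss_key _ _ _ _ _ _ _ _ s) setT.
pose grads := joint (@ss_grad _ _ _ _ _ _ _ _ s) setT.
apply: (message_length_lower_bound (D := D) (k0 := k0) (q := keys) (q0 := keys w0) NrN
  _ _ _ (ss_decodability s)).
- by rewrite Dk0 /t subnKC // ltnW.
- move=> v.
  pose T (i : key_group N S + 'I_K) : finType :=
    match i with inl V => ss_keyT s V | inr _ => 'rV[F]_L end.
  pose X (i : key_group N S + 'I_K) : ss_space s -> T i :=
    match i with inl V => ss_key V | inr k => ss_grad k end.
  pose x (i : key_group N S + 'I_K) : T i :=
    match i with inl V => ss_key V w0 | inr k => v k end.
  have [||i|w Pw Xw] := @additive_entropy_support R _ (ss_prob s) #|F| _ _ T X
    (pairrv keys grads) x F1.
  + move=> w w' XX; congr pair; apply: jointE_in => i _.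
      exact: (XX (inl i)).
    exact: (XX (inr i)).
  + by rewrite ss_indep big_sumType.
  + case: i => [V|k] /=; first exact: law_gt0.
    by apply: uniform_law_gt0; have [_] := ss_gradP s; apply.
  exists w; split=> // [|k]; last exact: (Xw (inr k)).
  by apply: jointE_in => V _; exact: (Xw (inl V)).
move=> n w w' Pw Pw' qq gg.
have /(cond_entropy_eq0 _ F1) := ss_encoding s n; apply=> //.
congr pair; first by apply: jointE_in => k /gg.
apply: jointE_in => V _.
exact: (joint_inj_in qq (in_setT V)).
Qed.

End Converse.

(** Complementation takes the key groups to the sets of [N - S] roots over which [vanishing_span]
    sums. *)
Lemma sum_key_groups (V : nmodType) (N S : nat) (f : {set 'I_N} -> V) :
  (S <= N)%N ->
  \sum_(W : key_group N S) f (~: val W) =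
  \sum_(A : {set 'I_N} | #|A| == (N - S)%N) f A.
Proof.
move=> SN; transitivity (\sum_(A : {set 'I_N} | #|A| == S) f (~: A)).
  rewrite [RHS](reindex_omap (val : key_group N S -> _) insub) /= => [|A AS]; last first.
    by rewrite insubT.
  by apply: eq_bigl => -[A AS] /=; rewrite insubT ?AS /= eqxx.
rewrite [RHS](reindex_inj (@setC_inj _)); apply: eq_bigl => A.
have := cardsC A; rewrite card_ord => cA.
by apply/eqP/eqP; lia.
Qed.

(** * Schemes of cost [1/t] from polynomial codes *)

Section Achievability.
Variables (R : realType) (F : finFieldType) (E : fieldExtType F).
Variables (K N Nr M : nat) (D : 'I_K -> {set 'I_N}) (alpha : 'I_N -> E).
Hypothesis alpha_inj : injective alpha.
Hypotheses (NrN : (Nr <= N)%N) (MN : (M < N)%N) (NMNr : (N - M < Nr)%N).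
(** Only [M] holders of each dataset are used, so that every modulus has degree exactly
    [a = N - M]. *)
Variable D' : 'I_K -> {set 'I_N}.
Hypotheses (D'D : forall k, D' k \subset D k) (cardD' : forall k, #|D' k| = M).
Let a := (N - M)%N.
Let t := (Nr - (N - M))%N.
Local Notation m := (dim E).
Local Notation vanishing := (vanishing alpha).
Local Notation grad := ('rV[F]_(t * m)).

Lemma ext_dim_gt0 : (0 < m)%N.
Proof. by rewrite -dimvf adim_gt0. Qed.

Lemma comm_cost_constant : comm_cost R (t * m) (fun _ : 'I_N => m) = t%:R^-1.
Proof.
rewrite /comm_cost.
have -> : \max_(n < N) m = m.
  apply/eqP; rewrite eqn_leq; apply/andP; split; first by apply/bigmax_leqP.
  have N0 : (0 < N)%N by apply: leq_ltn_trans MN.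
  exact: (leq_bigmax (Ordinal N0)).
have m0 : m%:R != 0 :> R by rewrite pnatr_eq0 -lt0n ext_dim_gt0.
by rewrite natrM invfM mulrCA divff // mulr1.
Qed.

Definition dataset_codeword k (v : grad) : {poly E} :=
  codeword a (vanishing (~: D' k)) v.

Lemma dataset_codeword_unavailable k v n :
  n \notin D k -> (dataset_codeword k v).[alpha n] = 0.
Proof.
move=> nD; apply: codeword_root; rewrite /root vanishing_root ?eqxx // inE.
by apply: contra nD; apply: (subsetP (D'D k)).
Qed.

(** The part of degree below [a] of the summed codewords. It may reveal more than the sum of the
    gradients and is what the keys have to hide. *)
Definition remainder (g : 'I_K -> grad) : {poly E} :=
  - \sum_k ('X^a * block_poly (g k)) %% vanishing (~: D' k).

Lemma size_remainder g : (size (remainder g) <= a)%N.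
Proof.
rewrite size_polyN (leq_trans (size_sum _ _ _)) //; apply/bigmax_leqP => k _.
have := ltn_modp ('X^a * block_poly (g k)) (vanishing (~: D' k)).
rewrite monic_neq0 ?vanishing_monic // size_vanishing ltnS.
suff -> : #|~: D' k| = a by [].
by have := cardsC (D' k); rewrite card_ord cardD' /a => cD; lia.
Qed.

Lemma sum_dataset_codeword g :
  \sum_k dataset_codeword k (g k) = 'X^a * block_poly (\sum_k g k) + remainder g.
Proof. by rewrite raddf_sum mulr_sumr -sumrB. Qed.

(** The terms [l] and [l'] are 0 in the linear scheme and the masks in the secure one; their degree
    is too small to disturb the top [t] coefficients. *)
Lemma sum_decode g g' (l l' : {poly E}) (U : {set 'I_N}) :
  (size l <= a)%N -> (size l' <= a)%N -> #|U| = Nr ->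
  (forall n, n \in U -> (\sum_k dataset_codeword k (g k) + l).[alpha n] =
                        (\sum_k dataset_codeword k (g' k) + l').[alpha n]) ->
  \sum_k g k = \sum_k g' k.
Proof.
move=> la la' cU eqU.
apply: (codeword_form_decode alpha_inj (a := a) (l := remainder g + l)
  (l' := remainder g' + l') (U := U)).
- by rewrite (leq_trans (size_polyD _ _)) // geq_max size_remainder.
- by rewrite (leq_trans (size_polyD _ _)) // geq_max size_remainder.
- by rewrite cU /a /t subnKC // ltnW.
by move=> n /eqU; rewrite !sum_dataset_codeword -!addrA.
Qed.

Definition dataset_symbol n k (v : grad) : 'rV[F]_m :=
  v2r (dataset_codeword k v).[alpha n].

Lemma dataset_symbol_linear n k : linear (dataset_symbol n k).
Proof.
move=> c u v; rewrite /dataset_symbol /dataset_codeword raddfD /= codewordZ.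
by rewrite hornerD hornerZ mulr_algl linearP.
Qed.

HB.instance Definition _ n k :=
  GRing.isLinear.Build F grad 'rV[F]_m _ (dataset_symbol n k)
    (dataset_symbol_linear n k).

Lemma available_sum n (g : 'I_K -> grad) :
  \sum_(k in available D n) (dataset_codeword k (g k)).[alpha n] =
  (\sum_k dataset_codeword k (g k)).[alpha n].
Proof.
rewrite horner_sum [RHS](bigID (mem (available D n))) /= [X in _ = _ + X]big1 ?addr0 //.
by move=> k; rewrite inE; apply: dataset_codeword_unavailable.
Qed.

Lemma exists_linear_scheme :
  exists s : linear_scheme R F Nr D (t * m), comm_cost R (t * m) (ls_len s) = t%:R^-1.
Proof.
(* The index type [void] leaves no key coordinates. *)
pose w0 : {ffun 'I_K -> grad} * {ffun void -> unit} := ([ffun=> 0], [ffun=> tt]).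
pose coef n k : 'M[F]_(t * m, m) := lin1_mx (dataset_symbol n k).
have dec : decodable Nr (uniform_fdist R w0) (fun k w => w.1 k)
    (fun n (w : {ffun 'I_K -> grad} * {ffun void -> unit}) =>
       \sum_(k in available D n) w.1 k *m coef n k).
  move=> U cU; apply/(cond_entropy_eq0 _ (finNzRing_gt1 F)).
  move=> w w' _ _ eqJ.
  apply: (@sum_decode w.1 w'.1 0 0 U); rewrite ?size_poly0 // => n nU.
  have := joint_inj_in eqJ nU; rewrite !addr0 -!available_sum.
  under eq_bigr do rewrite mul_rV_lin1 /= /dataset_symbol.
  under [RHS]eq_bigr do rewrite mul_rV_lin1 /= /dataset_symbol.
  by rewrite -!raddf_sum => /(can_inj v2rK).
exists (@LinearScheme R F K N Nr D _ _ _ _ (uniform_gradient_source R w0)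
  (fun=> m) coef dec).
exact: comm_cost_constant.
Qed.

Section Secure.
Variable S : nat.
Hypotheses (S0 : (0 < S)%N) (MS : (M < S)%N) (SN : (S <= N)%N).
(** A key has [S - M] coefficients in [E]: times a vanishing polynomial of degree [N - S], it gives
    degree below [N - M = a]. *)
Local Notation key := ('rV[F]_((S - M) * m)).
Local Notation keys := {ffun key_group N S -> key}.
Local Notation space := ({ffun 'I_K -> grad} * keys)%type.

Definition mask (q : keys) : {poly E} :=
  \sum_V vanishing (~: val V) * block_poly (q V).

Lemma size_mask q : (size (mask q) <= a)%N.
Proof.
rewrite (leq_trans (size_sum _ _ _)) //; apply/bigmax_leqP => V _.
have [->|nz] := eqVneq (block_poly (q V)) 0; first by rewrite mulr0 size_poly0.
have cV : #|~: val V| = (N - S)%N.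
  by have := cardsC (val V); rewrite card_ord (eqP (valP V)); lia.
rewrite size_monicM ?vanishing_monic // size_vanishing cV addSn /=.
by rewrite (leq_trans (leq_add (leqnn _) (size_block_poly _))) // /a; lia.
Qed.

(** Since [S > M], [N - S < a], and [vanishing_span] started from the empty set gives cofactors of
    size at most [a - (N - S) = S - M], which keys can represent. *)
Lemma mask_onto (l : {poly E}) : (size l <= a)%N -> exists q, mask q = l.
Proof.
move=> la.
have [||||c [sc ec]] := vanishing_span alpha_inj (a := a) (s := N - S) _ _
  (B := set0) (r := l).
- by rewrite /a; lia.
- by rewrite /a; lia.
- by rewrite cards0.
- by rewrite cards0 subn0.
have qP V : {v : key | block_poly v == c (~: val (V : key_group N S))}.
  apply/sigW; have := sc (~: val V).
  have -> : (a - (N - S) = S - M)%N by rewrite /a; lia.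
  by move/block_poly_onto => [v <-]; exists v.
exists [ffun V => sval (qP V)]; rewrite /mask.
under eq_bigr do rewrite ffunE (eqP (svalP (qP _))).
rewrite (sum_key_groups (fun A => vanishing A * c A)) // -ec.
by rewrite /vanishing big_set0 mul1r.
Qed.

Lemma maskD (q q' : keys) : mask [ffun V => q V + q' V] = mask q + mask q'.
Proof.
by rewrite -big_split; apply: eq_bigr => V _; rewrite ffunE raddfD mulrDr.
Qed.

Definition secure_poly (w : space) : {poly E} :=
  \sum_k dataset_codeword k (w.1 k) + mask w.2.

Definition secure_msg (n : 'I_N) (w : space) : 'rV[F]_m :=
  v2r (secure_poly w).[alpha n].

Let w0 : space := ([ffun=> 0], [ffun=> 0]).
Local Notation P := (uniform_fdist R w0).
Local Notation grads := (fun k (w : space) => w.1 k).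
Local Notation groupkeys := (fun V (w : space) => w.2 V).

Lemma secure_encoding n :
  cond_entropy P #|F| (secure_msg n)
    (pairrv (joint grads (available D n)) (joint groupkeys (known_keys S n))) = 0.
Proof.
apply/(cond_entropy_eq0 _ (finNzRing_gt1 F)) => w w' _ _ [eqg eqk].
rewrite /secure_msg /secure_poly !hornerD -!available_sum /mask !horner_sum.
congr (v2r (_ + _)).
  by apply: eq_bigr => k kn; rewrite (joint_inj_in eqg kn).
apply: eq_bigr => V _; rewrite !hornerM.
have [nV|nV] := boolP (n \in val V); last by rewrite vanishing_root ?mul0r // inE.
by rewrite (joint_inj_in eqk) // inE.
Qed.

Lemma secure_decodability : decodable Nr P grads secure_msg.
Proof.
move=> U cU; apply/(cond_entropy_eq0 _ (finNzRing_gt1 F)) => w w' _ _ eqJ.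
apply: (@sum_decode _ _ (mask w.2) (mask w'.2) U) => [||//|n nU]; rewrite ?size_mask //.
by have /(can_inj v2rK) := joint_inj_in eqJ nU.
Qed.

(** For equal sums of gradients the unmasked polynomials differ by a difference of remainders, of
    degree below [a]. Some key tuple [q0] masks to this difference; translating the keys by [q0] is
    injective and compensates for the change of gradients in every message. *)
Lemma secure_security :
  cond_mutual_info P #|F| (joint secure_msg setT) (joint grads setT)
    (fun w => \sum_k w.1 k) = 0.
Proof.
apply: (@masked_mutual_info0 R #|F| _ _ _ _ _ w0 _ _
  (fun g : {ffun 'I_K -> grad} => \sum_k g k)).
  move=> w w'; apply/eqP/eqP => [eqJ|ww]; last by apply: jointE_in => k _; rewrite ww.
  by apply/ffunP=> k; apply: (joint_inj_in eqJ (in_setT k)).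
move=> g g' sg.
have [q0 mq0] : exists q, mask q = remainder g - remainder g'.
  apply: mask_onto; rewrite (leq_trans (size_polyD _ _)) // geq_max.
  by rewrite size_remainder size_polyN size_remainder.
exists (fun q : keys => [ffun V => q V + q0 V] : keys).
  move=> q q' /ffunP qq; apply/ffunP=> V; have := qq V.
  by rewrite !ffunE => /addIr.
move=> q; apply: jointE_in => n _; rewrite /secure_msg /secure_poly maskD mq0.
congr (v2r _.[_]); rewrite /= !sum_dataset_codeword sg.
by ring.
Qed.

Lemma secure_indep :
  entropy P #|F| (pairrv (joint groupkeys setT) (joint grads setT)) =
  \sum_V entropy P #|F| (groupkeys V) + \sum_k entropy P #|F| (grads k).
Proof.
apply: product_space_entropy => w w' [eqk eqg].
rewrite [w]surjective_pairing [w']surjective_pairing; congr pair; apply/ffunP=> i.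
  exact: (joint_inj_in eqg (in_setT i)).
exact: (joint_inj_in eqk (in_setT i)).
Qed.

Lemma exists_secure_scheme :
  exists s : secure_scheme R F Nr S D (t * m),
    comm_cost R (t * m) (ss_len s) = t%:R^-1.
Proof.
exists (@SecureScheme R F K N Nr S D _ _ _ _ (uniform_gradient_source R w0)
  (fun=> key) groupkeys secure_indep (fun=> m) secure_msg
  secure_encoding secure_decodability secure_security).
exact: comm_cost_constant.
Qed.

End Secure.
End Achievability.

Lemma inf_attained (R : realType) (A : set R) (x : R) :
  A x -> lbound A x -> inf A = x.
Proof.
move=> Ax lb; apply/eqP; rewrite eq_le ge_inf //=; last by exists x.
by rewrite lb_le_inf //; exists x.
Qed.

Section Optimal.
Variables (R : realType) (F : finFieldType) (K N Nr M : nat).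
Variable D : 'I_K -> {set 'I_N}.
Hypotheses (NrN : (Nr <= N)%N) (MN : (M < N)%N) (NMNr : (N - M < Nr)%N).
Hypothesis repD : min_replication D M.

Lemma exists_minimal_assignment : exists D' : 'I_K -> {set 'I_N},
  (forall k, D' k \subset D k) /\ (forall k, #|D' k| = M).
Proof.
have DP k : {B : {set 'I_N} | (B \subset D k) && (#|B| == M)}.
  apply/sigW; have [B BD cB] := exists_subset_card (proj1 repD k).
  by exists B; rewrite BD cB eqxx.
by exists (fun k => sval (DP k)); split=> k; have /andP[? /eqP] := svalP (DP k).
Qed.

Lemma block_length_gt0 (E : fieldExtType F) : (0 < (Nr - (N - M)) * dim E)%N.
Proof. by rewrite muln_gt0 subn_gt0 NMNr ext_dim_gt0. Qed.

Lemma optimal_linear_costE :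
  optimal_linear_cost R F Nr D = (Nr - (N - M))%:R^-1.
Proof.
have [E [alpha alpha_inj]] := extension_with_points F N.
have [D' [D'D cD']] := exists_minimal_assignment.
apply: inf_attained => [|_ [L [L0 [s ->]]]]; last exact: linear_cost_ge.
have [s sE] := exists_linear_scheme R alpha_inj NrN MN NMNr D'D cD'.
by exists ((Nr - (N - M)) * dim E)%N; split; [exact: block_length_gt0|exists s].
Qed.

Lemma optimal_secure_costE S : (0 < S)%N -> (M < S)%N -> (S <= N)%N ->
  optimal_secure_cost R F Nr S D = (Nr - (N - M))%:R^-1.
Proof.
move=> S0 MS SN.
have [E [alpha alpha_inj]] := extension_with_points F N.
have [D' [D'D cD']] := exists_minimal_assignment.
apply: inf_attained => [|_ [L [L0 [s ->]]]]; last exact: secure_cost_ge.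
have [s sE] := exists_secure_scheme R alpha_inj NrN MN NMNr D'D cD' S0 MS SN.
by exists ((Nr - (N - M)) * dim E)%N; split; [exact: block_length_gt0|exists s].
Qed.

End Optimal.

(** * Comparison of the groupwise-key cost with the non-secure optimum *)

(** This is the factor-2 bound cleared of denominators. It follows from [binomial_decay], as
    [Nr <= N] and the lower bound on [S] give [2 <= S]. *)
Lemma binomial_ratio_bound (N Nr M S : nat) : (M < N)%N -> (N - M < Nr)%N ->
  (Nr <= N)%N -> (N - Nr + 2 <= S)%N -> (S <= M)%N ->
  ('C(M, S) * (Nr + (N - M)) <= 'C(N, S) * (Nr - (N - M)))%N.
Proof.
move=> MN NMNr NrN Slo SM.
have := binomial_decay (N - M) (_ : 2 <= S)%N SM.
rewrite subnKC ?(ltnW MN) // => /(_ ltac:(lia)).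
set c := 'C(M, S); set C := 'C(N, S).
have [a ea] : exists a, N = (M + a)%N by exists (N - M)%N; lia.
have [e ee] : exists e, M = (S + e)%N by exists (M - S)%N; lia.
(* The lower bound on [S] amounts to [a + e + 2 <= Nr]. *)
have [f ef] : exists f, Nr = (a + (e + 2 + f))%N by exists (Nr - a - e - 2)%N; lia.
have -> : (N - S = e + a)%N by lia.
have -> : (M - S = e)%N by lia.
have -> : (Nr + (N - M) = e + 2 + f + 2 * a)%N by lia.
have -> : (Nr - (N - M) = e + 2 + f)%N by lia.
move: c C => c C decay {ea ee ef MN NMNr NrN Slo SM}.
rewrite -(@leq_pmul2r ((e + a).+1 * (e + a).+2)) //.
apply: (@leq_trans (C * (e.+1 * e.+2) * (e + 2 + f + 2 * a))).
  by rewrite mulnAC leq_mul2r decay orbT.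
rewrite -!mulnA leq_mul2l; apply/orP; right.
(* The right side exceeds the left by [a(a+1)(e+2) + f a(a+2e+3)]. *)
nia.
Qed.

Theorem theorem2 (R : realType) (F : finFieldType) (K N Nr M S : nat)
    (D : 'I_K -> {set 'I_N})
    (hK : (0 < K)%N) (hN : (0 < N)%N) (hNr : (0 < Nr)%N) (hM : (0 < M)%N)
    (hS : (0 < S)%N)
    (hNrN : (Nr <= N)%N) (hMN : (M < N)%N) (hNMNr : (N - M < Nr)%N)
    (hSlo : (N - Nr + 2 <= S)%N) (hSN : (S <= N)%N)
    (hD : min_replication D M) :
  ((M < S)%N ->
     [/\ groupwise_key_cost R N Nr M S = optimal_linear_cost R F Nr D,
         optimal_secure_cost R F Nr S D = optimal_linear_cost R F Nr D
       & optimal_linear_cost R F Nr D = 1 / (Nr%:R - N%:R + M%:R)]) /\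
  ((N - Nr + 2 <= S <= M)%N ->
     optimal_linear_cost R F Nr D <= groupwise_key_cost R N Nr M S
       <= 2 * optimal_linear_cost R F Nr D).
Proof.
have eqt : (Nr - (N - M))%:R = Nr%:R - N%:R + M%:R :> R.
  by rewrite natrB ?(ltnW hNMNr) // natrB ?(ltnW hMN) //; ring.
have t_gt0 : 0 < Nr%:R - N%:R + M%:R :> R by rewrite -eqt ltr0n subn_gt0.
have lin := optimal_linear_costE R F hNrN hMN hNMNr hD.
have binN : 0 < 'C(N, S)%:R :> R by rewrite ltr0n bin_gt0.
rewrite /groupwise_key_cost; split=> [MS|/andP[_ SM]].
  have sec := optimal_secure_costE R F hNrN hMN hNMNr hD hS MS hSN.
  rewrite lin sec eqt div1r (bin_small MS) subr0 -mulrBr; split=> //.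
  rewrite invfM mulrA divff ?gt_eqF // mul1r; congr _^-1; ring.
rewrite lin eqt.
have := binomial_ratio_bound hMN hNMNr hNrN hSlo SM.
rewrite -(ler_nat R) !natrM eqt natrD natrB ?(ltnW hMN) //.
have C_ge0 : 0 <= 'C(M, S)%:R :> R by [].
have NM : 0 < N%:R - M%:R :> R by rewrite subr_gt0 ltr_nat.
move: binN C_ge0 t_gt0 NM.
set C := 'C(N, S)%:R; set c := 'C(M, S)%:R.
set n := N%:R; set r := Nr%:R; set mu := M%:R => C_gt0 c_ge0 t_gt0 NM ratio.
set den := (C - c) * r - C * (n - mu).
(* [2 * den] minus the left side is [C (r - n + mu) - c (r + n - mu)], nonnegative by [ratio]. *)
have upper : (C - c) * (r - n + mu) <= 2 * den by rewrite /den; nra.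
(* If [C <= c], then [ratio] would give [C (r + n - mu) <= C (r - n + mu)], against [C > 0] and
   [n > mu]. *)
have C_gt_c : 0 < C - c.
  rewrite subr_gt0 ltNge; apply/negP => Cc; nra.
have den_gt0 : 0 < den by have := mulr_gt0 C_gt_c t_gt0; lra.
apply/andP; split.
  (* The lower bound amounts to [0 <= c (n - mu)]. *)
  rewrite ler_pdivlMr // ler_pdivrMl //.
  rewrite /den; nra.
by rewrite ler_pdivrMr // mulrAC ler_pdivlMr.
Qed.
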